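(* Let $(X,\rho)$ be a geometrically doubling quasi-metric space with constants $A_0,A_1$. Suppose $\delta\in(0,1)$ satisfies $96A_0^6\delta\le1$, and let a set of reference points $\{x^k_\alpha\}$, $k\in\mathbb{Z}$, $\alpha\in\mathscr{A}_k$, be given. Then there exists a probability space $(\Omega,\mathbb{P})$ such that every $\omega\in\Omega$ defines a dyadic system $\mathscr{D}(\omega)=\{Q^k_\alpha(\omega)\}_{k,\alpha}$, related to new dyadic points $\{z^k_\alpha(\omega)\}_{k,\alpha}$, with the dyadic properties (1)--(5) listed in the context. Further, $(\Omega,\mathbb{P})$ has the following properties: (a) $\Omega=\prod_{k\in\mathbb{Z}}\Omega_k$, each $\omega=(\omega_k)_{k\in\mathbb{Z}}\in\Omega$ having coordinates $\omega_k\in\Omega_k$ which are independent; (b) $z^k_\alpha(\omega)=z^k_\alpha(\omega_k)$, i.e. $z^k_\alpha(\omega)$ depends on $\omega$ only through the coordinate $\omega_k$; (c) there is a constant $\tau_0>0$ such that, whenever $(k+1,\beta)\le(k,\alpha)$, $\mathbb{P}(\{\omega\in\Omega: z^k_\alpha(\omega)=x^{k+1}_\beta\})\ge\tau_0$.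
   Context: A quasi-metric $\rho$ on $X$ satisfies the axioms of a metric except that the triangle inequality is weakened to $\rho(x,y)\le A_0(\rho(x,z)+\rho(z,y))$ with $A_0\ge1$. Balls are $B(x,r):=\{y\in X:\rho(y,x)<r\}$. Geometric doubling: there is $A_1\in\mathbb{N}$ such that every ball $B(x,r)$ can be covered by at most $A_1$ balls of radius $r/2$. A set $\Omega'$ is open if each $x\in\Omega'$ has some $B(x,\varepsilon)\subseteq\Omega'$, $\varepsilon>0$; interior and closure refer to this topology. Reference points (for the given $\delta$): for every $k\in\mathbb{Z}$ a family $\{x^k_\alpha\}_{\alpha\in\mathscr{A}_k}\subseteq X$, $\mathscr{A}_k$ countable, with $\rho(x^k_\alpha,x^k_\beta)\ge\delta^k$ for $\alpha\ne\beta$ and $\min_\alpha\rho(x,x^k_\alpha)<\delta^k$ for all $x\in X$. A partial order $\le$ on index pairs is fixed: each $(k+1,\beta)$ has exactly one parent $(k,\alpha)$, written $(k+1,\beta)\le(k,\alpha)$, chosen so that $\rho(x^{k+1}_\beta,x^k_\alpha)<(2A_0)^{-1}\delta^k$ implies $(k+1,\beta)\le(k,\alpha)$, and $(k+1,\beta)\le(k,\alpha)$ implies $\rho(x^{k+1}_\beta,x^k_\alpha)<\delta^k$; $\le$ is extended to all levels by reflexivity and transitivity. If $(k+1,\beta)\le(k,\alpha)$, then $(k+1,\beta)$ is called a child of $(k,\alpha)$. Constants: $c_0:=(4A_0^2)^{-1}$, $C_0:=2A_0$, $c_1:=(3A_0^2)^{-1}c_0$, $C_1:=2A_0C_0$.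 New dyadic points are points $z^k_\alpha$, $k\in\mathbb{Z}$, $\alpha\in\mathscr{A}_k$, each of the form $z^k_\alpha=x^{k+1}_\beta$ for some child $(k+1,\beta)\le(k,\alpha)$, such that $\rho(z^k_\alpha,z^k_\beta)\ge c_0\delta^k$ for $\alpha\neq\beta$ and $\min_\alpha\rho(x,z^k_\alpha)<C_0\delta^k$ for all $x\in X$. Dyadic system related to new dyadic points $\{z^k_\alpha\}$: the points determine their own partial order $\preceq$ (for $z=z(\omega)$, written $\le_\omega$): with $\mathscr{A}_k\subseteq\mathbb{N}$, the parent of $(k+1,\beta)$ is the unique $(k,\alpha)$ with $\rho(z^{k+1}_\beta,z^k_\alpha)<(2A_0)^{-1}c_0\delta^k$ if it exists, and otherwise the $(k,\alpha)$ with smallest $\alpha$ such that $\rho(z^{k+1}_\beta,z^k_\alpha)<C_0\delta^k$; extend by reflexivity and transitivity. Put $\hat Q^k_\alpha:=\{z^\ell_\beta:(\ell,\beta)\preceq(k,\alpha)\}$, let $\bar Q^k_\alpha$ be the closure of $\hat Q^k_\alpha$, and $\tilde Q^k_\alpha:=X\setminus\bigcup_{\beta\ne\alpha}\bar Q^k_\beta$. The system consists of (half-open) cubes $Q^k_\alpha$ with $\tilde Q^k_\alpha\subseteq Q^k_\alpha\subseteq\bar Q^k_\alpha$. Dyadic properties: (1) $\tilde Q^k_\alpha$ and $\bar Q^k_\alpha$ are the interior and closure of $Q^k_\alpha$; (2) if $\ell\ge k$, then either $Q^\ell_\beta\subseteq Q^k_\alpha$ or $Q^k_\alpha\cap Q^\ell_\beta=\varnothing$;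 (3) $X=\bigcup_\alpha Q^k_\alpha$ (disjoint union) for every $k$; (4) $B(z^k_\alpha,c_1\delta^k)\subseteq Q^k_\alpha\subseteq B(z^k_\alpha,C_1\delta^k)=:B(Q^k_\alpha)$; (5) if $k\le\ell$ and $Q^\ell_\beta\subseteq Q^k_\alpha$, then $B(Q^\ell_\beta)\subseteq B(Q^k_\alpha)$. *)

(* Defs.v *)
From HB Require Import structures.
From Stdlib Require Export Relation_Operators.
From mathcomp Require Export all_boot all_order all_algebra.
From mathcomp Require Export finmap.
From mathcomp Require Export all_classical all_reals all_analysis.

Set Implicit Arguments.
Unset Strict Implicit.
Unset Printing Implicit Defensive.

Import Order.TTheory GRing.Theory Num.Theory.

Local Open Scope classical_set_scope.
Local Open Scope ring_scope.

Section QuasiMetric.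
Context {R : realType} {X : Type}.
Implicit Types rho : X -> X -> R.

Definition quasi_metric rho (A0 : R) : Prop :=
  [/\ 1 <= A0,
      forall x y, 0 <= rho x y,
      forall x y, rho x y = 0 <-> x = y,
      forall x y, rho x y = rho y x
    & forall x y z, rho x y <= A0 * (rho x z + rho z y)].

Definition qball rho (x : X) (r : R) : set X := [set y | rho y x < r].

Definition geometrically_doubling rho (A1 : nat) : Prop :=
  forall (x : X) (r : R), 0 < r -> exists (n : nat) (c : 'I_n -> X),
    (n <= A1)%N /\ qball rho x r `<=` \bigcup_i qball rho (c i) (r / 2).

Definition qopen rho (U : set X) : Prop :=
  forall x, U x -> exists2 e, 0 < e & qball rho x e `<=` U.

Lemma qopenT rho : qopen rho setT.
Proof. by move=> x _; exists 1. Qed.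

Lemma qopenI rho : setI_closed (qopen rho).
Proof.
move=> U V oU oV x [Ux Vx].
have [e e0 eU] := oU x Ux; have [f f0 fV] := oV x Vx.
exists (Num.min e f); first by rewrite lt_min e0.
by move=> y; rewrite /qball /= lt_min => /andP[ye yf]; split; [exact: eU|exact: fV].
Qed.

Lemma qopen_bigU rho (I : Type) (f : I -> set X) :
  (forall i, qopen rho (f i)) -> qopen rho (\bigcup_i f i).
Proof.
move=> of_ x [i _ fix_]; have [e e0 ef] := of_ i x fix_.
by exists e => // y /ef fy; exists i.
Qed.

(* X equipped with the topology of rho.  Balls need not be open in it. *)
Definition qtop rho : Type := X.

HB.instance Definition _ rho := gen_eqMixin (qtop rho).
HB.instance Definition _ rho := gen_choiceMixin (qtop rho).
HB.instance Definition _ rho := isOpenTopological.Build (qtop rho)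
  (qopenT rho) (@qopenI rho) (@qopen_bigU rho).

Definition qclosure rho (E : set X) : set X := @closure (qtop rho) E.
Definition qinterior rho (E : set X) : set X := @interior (qtop rho) E.

(* min_{a in D} rho(y, p a) < r; in particular the minimum is attained. *)
Definition min_dist_lt rho (D : set nat) (p : nat -> X) (y : X) (r : R) : Prop :=
  exists2 a, D a /\ (forall b, D b -> rho y (p a) <= rho y (p b))
           & rho y (p a) < r.

End QuasiMetric.

(* The pair (k, a) is the index a of level k.  A relation [par] between
   adjacent levels, where [par k b a] means that (k, a) is the parent of
   (k + 1, b), is extended to all levels by reflexivity and transitivity. *)
Definition index_le (par : int -> nat -> nat -> Prop) :
    int * nat -> int * nat -> Prop :=
  clos_refl_trans (int * nat)%type
    (fun p q => p.1 = q.1 + 1 /\ par q.1 p.2 q.2).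

Section Constants.
Context {R : realType}.
Definition c_0 (A0 : R) : R := (4 * A0 ^+ 2)^-1.
Definition C_0 (A0 : R) : R := 2 * A0.
Definition c_1 (A0 : R) : R := (3 * A0 ^+ 2)^-1 * c_0 A0.
Definition C_1 (A0 : R) : R := 2 * A0 * C_0 A0.
End Constants.

(* The countable index set of level k is a subset A k of nat; the values of
   x k, z k and Q k outside A k are irrelevant. *)
Section Dyadic.
Context {R : realType} {X : Type}.
Variables (rho : X -> X -> R) (A0 delta : R) (A : int -> set nat).
Implicit Types (x z : int -> nat -> X) (par : int -> nat -> nat -> Prop)
  (Q : int -> nat -> set X).

Definition reference_points x : Prop :=
  (forall k a b, A k a -> A k b -> a <> b ->
     delta ^ k <= rho (x k a) (x k b)) /\
  (forall k y, min_dist_lt rho (A k) (x k) y (delta ^ k)).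

Definition reference_order x par : Prop :=
  [/\ forall (k : int) b a, par k b a -> A (k + 1) b /\ A k a,
      forall (k : int) b, A (k + 1) b -> exists! a, par k b a,
      forall (k : int) b a, A (k + 1) b -> A k a ->
        rho (x (k + 1) b) (x k a) < (2 * A0)^-1 * delta ^ k -> par k b a
    & forall (k : int) b a, par k b a -> rho (x (k + 1) b) (x k a) < delta ^ k].

Definition new_dyadic_points x par z : Prop :=
  [/\ forall k a, A k a -> exists2 b,
        index_le par (k + 1, b) (k, a) & z k a = x (k + 1) b,
      forall k a b, A k a -> A k b -> a <> b ->
        c_0 A0 * delta ^ k <= rho (z k a) (z k b)
    & forall k y, min_dist_lt rho (A k) (z k) y (C_0 A0 * delta ^ k)].

(* [near_parent] holds for at most one a in A k, by the c_0-separation of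
   the points z k. *)
Definition near_parent z (k : int) b a : Prop :=
  A k a /\ rho (z (k + 1) b) (z k a) < (2 * A0)^-1 * c_0 A0 * delta ^ k.

Definition fallback_parent z (k : int) b a : Prop :=
  A k a /\ rho (z (k + 1) b) (z k a) < C_0 A0 * delta ^ k.

Definition new_parent z (k : int) b a : Prop :=
  A (k + 1) b /\
  (near_parent z k b a \/
   [/\ ~ (exists a', near_parent z k b a'),
       fallback_parent z k b a
     & forall a', fallback_parent z k b a' -> (a <= a')%N]).

Definition new_le z : int * nat -> int * nat -> Prop := index_le (new_parent z).

Definition Qhat z k a : set X :=
  [set y | exists l b, new_le z (l, b) (k, a) /\ y = z l b].

Definition Qbar z k a : set X := qclosure rho (Qhat z k a).

Definition Qtilde z k a : set X :=
  ~` \bigcup_(b in [set b | A k b /\ b <> a]) Qbar z k b.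

Definition dyadic_system z Q : Prop :=
  forall k a, A k a -> Qtilde z k a `<=` Q k a /\ Q k a `<=` Qbar z k a.

(* The ball B(Q^k_a). *)
Definition cube_ball z k a : set X := qball rho (z k a) (C_1 A0 * delta ^ k).

Definition dyadic_properties z Q : Prop :=
  [/\ forall k a, A k a ->
        Qtilde z k a = qinterior rho (Q k a) /\
        Qbar z k a = qclosure rho (Q k a),
      forall k l a b, A k a -> A l b -> k <= l ->
        Q l b `<=` Q k a \/ Q k a `&` Q l b = set0,
      forall k, \bigcup_(a in A k) Q k a = setT /\ trivIset (A k) (Q k),
      forall k a, A k a ->
        qball rho (z k a) (c_1 A0 * delta ^ k) `<=` Q k a /\
        Q k a `<=` cube_ball z k a
    & forall k l a b, A k a -> A l b -> k <= l ->
        Q l b `<=` Q k a -> cube_ball z l b `<=` cube_ball z k a].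

End Dyadic.

Section Product.
Context {d : int -> measure_display} (T : forall k, measurableType (d k)).

Definition cylinders : set (set (forall k, T k)) :=
  [set B | exists k (E : set (T k)), measurable E /\ B = [set w | E (w k)]].

(* The product of the T k, with the product sigma-algebra. *)
Definition prod_space := g_sigma_algebraType cylinders.

Definition independent_coordinates {R : realType}
    (P : set prod_space -> \bar R) : Prop :=
  forall (J : {fset int}) (E : forall k, set (T k)),
    (forall k : int, k \in J -> measurable (E k)) ->
    (P (\bigcap_(k in [set` J]) [set w : prod_space | E k (w k)]) =
     \prod_(k <- J) P [set w : prod_space | E k (w k)])%E.

End Product.

(* Main.v *)
From HB Require Import structures.
Require Import Defs.
From Stdlib Require Import Operators_Properties.
From mathcomp Require Import ring lra zify.

Set Implicit Arguments.
Unset Strict Implicit.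
Unset Printing Implicit Defensive.

Import Order.TTheory GRing.Theory Num.Theory.
Import numFieldNormedType.Exports.

Local Open Scope classical_set_scope.
Local Open Scope ring_scope.

(** Each child of an index of level [k] gets a colour among [0, ..., N], so that
    two points [x (k + 1) b], [x (k + 1) c] closer than [2 * A0 * delta ^ k]
    have different colours; by doubling, [N] does not depend on [k]
    ([conflict_coloring]).  The coordinate [w k] is a uniformly random colour,
    and [z w k a] is the child of [(k, a)] of colour [w k], or, when there is
    none, a child very close to [x k a], called central ([designated]).  Siblings have distinct
    colours, so every child is chosen with probability at least [1 / (N + 1)].
    The chosen points stay separated ([designated_sep]): two points chosen by
    colour are far apart because their colours agree, and a child closer than
    [c_0 A0 * delta ^ k] to a central child of [(k, a)] would be so close to
    [x k a] that [(k, a)] would be its parent.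

    The rest is deterministic: separated and dense points carry dyadic cubes
    ([dyadic_cubes_ex]).  The smallness of [delta] makes distances along a chain
    of parents sum to a geometric series dominated by its first term
    ([descendant_dist], [near_descendant_dist]) and shows that the small ball
    around [z k a] meets no [Qbar k b] with [b <> a] ([small_ball_Qbar]).
    Every point [y] of the space has a branch, a choice of one index per level
    that is compatible with the parents and such that [y] lies in all the
    corresponding sets [Qbar]: approximate [y] by points of level [n] and take
    the limit of their ancestors along an ultrafilter in [n] ([branch_ex]).
    The cube [Q k a] consists of the points whose branch passes through
    [(k, a)].  Partition and nestedness are then immediate, the inclusion of the
    small ball says that the branch of [z l b] passes through [(l, b)], and
    the topological statements follow since only finitely many of the [Qbar k b]
    come near a given point.

    Independent uniform colours are obtained from the digits in base [N + 1] of
    a uniform random number in the unit interval, one digit position for each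
    integer [k] ([iid_uniform_ex]). *)

(** * Ancestors in a tree of indices *)

Section IndexTree.
Variables (A : int -> set nat) (par : int -> nat -> nat -> Prop).

Lemma index_le_level k l a b : index_le par (l, b) (k, a) -> k <= l.
Proof.
have H p q : index_le par p q -> q.1 <= p.1.
  elim=> {p q} [p q [-> _] | p | p q r _ pq _ qr]; first by lia.
    by [].
  exact: le_trans qr pq.
exact: H.
Qed.

Lemma index_le_last k l a b : index_le par (l, b) (k, a) ->
  (l = k /\ b = a) \/
  exists c, index_le par (l, b) (k + 1, c) /\ par k c a.
Proof.
have H p q : index_le par p q -> p = q \/
    exists2 r, index_le par p r & r.1 = q.1 + 1 /\ par q.1 r.2 q.2.
  move=> pq; case: (clos_rt_rtn1 _ _ _ _ pq) => [ | r s rs pr]; first by left.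
  by right; exists r => //; exact: clos_rtn1_rt.
move=> /H [[-> ->] | [[m c] bc /= [mk ca]]]; first by left.
by right; exists c; split=> //; rewrite -mk.
Qed.

Lemma index_le_eq k a b : index_le par (k, b) (k, a) -> b = a.
Proof.
by move=> /index_le_last [[_ ->] // | [c [/index_le_level + _]]]; lia.
Qed.

Lemma index_le_child k a b : index_le par (k + 1, b) (k, a) -> par k b a.
Proof.
by move=> /index_le_last [[] | [c [/index_le_eq -> ]]] //; lia.
Qed.

Lemma index_le_step k a b : par k b a -> index_le par (k + 1, b) (k, a).
Proof. by move=> ba; apply: rt_step. Qed.

Lemma descendant_idx k l a b :
  (forall k b a, par k b a -> A (k + 1) b) ->
  A k a -> index_le par (l, b) (k, a) -> A l b.
Proof.
move=> par_idx_child Aa ba.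
suff H p q : index_le par p q -> A q.1 q.2 -> A p.1 p.2 by exact: (H _ _ ba).
elim=> {p q ba} [p q [-> /par_idx_child] // | // | p q r _ pq _ qr Ar].
exact/pq/qr.
Qed.

Hypothesis par_idx : forall k b a, par k b a -> A k a.
Hypothesis par_ex : forall k b, A (k + 1) b -> exists a, par k b a.
Hypothesis par_uniq : forall k b a a', par k b a -> par k b a' -> a = a'.

Lemma index_le_idx k l a b : A l b -> index_le par (l, b) (k, a) -> A k a.
Proof.
move=> Ab /index_le_last [[<- <-] // | [c [_ ]]]; exact: par_idx.
Qed.

Lemma ancestor_ex k l b : k <= l -> A l b ->
  exists a, index_le par (l, b) (k, a).
Proof.
move=> kl; have [n ->] : exists n : nat, l = k + n%:Z.
  by exists `|l - k|%N; lia.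
elim: n k {kl l} => [|n IH] k Ab.
  by exists b; rewrite addr0; exact: rt_refl.
have [|c bc] := IH (k + 1); first by have <- : k + n.+1%:Z = k + 1 + n by lia.
have kn : k + 1 + n = k + n.+1 by lia.
rewrite kn in bc.
have [a ca] := par_ex (index_le_idx Ab bc).
exists a; apply: rt_trans bc _; exact: index_le_step.
Qed.

Lemma ancestor_uniq k l b a a' :
  index_le par (l, b) (k, a) -> index_le par (l, b) (k, a') -> a = a'.
Proof.
move=> H; have kl := index_le_level H; move: H.
have [n ln] : exists n : nat, l = k + n%:Z by exists `|l - k|%N; lia.
rewrite {}ln {kl l}; elim: n k a a' => [|n IH] k a a'.
  by rewrite addr0 => /index_le_eq <- /index_le_eq.
have kn : k + n.+1%:Z = k + 1 + n by lia.
rewrite kn.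
move=> /index_le_last [[]| [c [bc ca]]]; first by lia.
move=> /index_le_last [[]| [c' [bc' ca']]]; first by lia.
by have cc' := IH _ _ _ bc bc'; subst c'; apply: par_uniq ca'.
Qed.

(** The ancestors of an index form a chain. *)
Lemma ancestor_chain k l m a b c : A l b -> k <= m ->
  index_le par (l, b) (k, a) -> index_le par (l, b) (m, c) ->
  index_le par (m, c) (k, a).
Proof.
move=> Ab km ba bc.
have [a' ca'] := ancestor_ex km (index_le_idx Ab bc).
by rewrite (ancestor_uniq ba (rt_trans _ _ _ _ _ bc ca')).
Qed.

End IndexTree.

(** * Quasi-metric topology and packing *)

Section QuasiMetricTopology.
Variables (R : realType) (X : Type) (rho : X -> X -> R) (A0 : R).
Hypothesis rho_qm : quasi_metric rho A0.

Lemma quasi_constant_gt0 : 0 < A0.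
Proof. by have [h _ _ _ _] := rho_qm; lra. Qed.

Lemma rho_refl x : rho x x = 0.
Proof. by have [_ _ h _ _] := rho_qm; apply/h. Qed.

Lemma rho_sym x y : rho x y = rho y x.
Proof. by have [_ _ _ h _] := rho_qm; apply: h. Qed.

Lemma rho_triangle_lt x z y a b c :
  rho x z < a -> rho z y < b -> A0 * (a + b) <= c -> rho x y < c.
Proof.
have [_ _ _ _ tri] := rho_qm => xz zy; apply: lt_le_trans.
apply: le_lt_trans (tri x y z) _.
by rewrite ltr_pM2l ?quasi_constant_gt0// ltrD.
Qed.

(** A path of [n] jumps from [x] to [y], the first of length below
    [e / (2 * A0) ^ (m + 1)] and each next bound smaller by [2 * A0]: the factor
    [2] sums the lengths and the factor [A0] pays for each use of the
    quasi-triangle inequality. *)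
Fixpoint shrinking_chain (e : R) (n m : nat) (x y : X) : Prop :=
  if n is n'.+1 then
    exists w, rho w x < e / (2 * A0) ^+ m.+1 /\ shrinking_chain e n' m.+1 w y
  else x = y.

Lemma shrinking_chain_rcons e n m x y w : shrinking_chain e n m x y ->
  rho w y < e / (2 * A0) ^+ (m + n).+1 -> shrinking_chain e n.+1 m x w.
Proof.
elim: n m x => [|n IH] m x /=.
  by move=> ->; rewrite addn0 => wy; exists w.
move=> [v [vx vy]]; rewrite addnS -addSn => wy.
by exists v; split=> //; exact: IH vy wy.
Qed.

Lemma shrinking_chain_lt e n m x y : 0 < e -> shrinking_chain e n m x y ->
  rho y x < e / (2 * A0) ^+ m.
Proof.
have A0p := quasi_constant_gt0.
move=> e0; elim: n m x => [|n IH] m x /=.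
  by move=> ->; rewrite rho_refl divr_gt0// exprn_gt0// mulr_gt0.
move=> [w [wx /IH yw]]; apply: rho_triangle_lt yw wx _.
rewrite le_eqVlt; apply/orP; left; apply/eqP.
rewrite exprS; field; rewrite ?expf_neq0 ?mulf_neq0//; lra.
Qed.

(** A ball need not be open, but the points that are reached from its centre by
    finitely many jumps of geometrically decreasing size form an open set inside
    it.  Closures and interiors can thus be computed with balls. *)
Lemma nbhs_qball x (E : set X) :
  @nbhs _ (qtop rho) x E <-> exists2 e, 0 < e & qball rho x e `<=` E.
Proof.
have A0p := quasi_constant_gt0.
rewrite nbhsE; split.
  move=> [U [oU Ux] UE]; have [e e0 eU] := oU x Ux.
  by exists e => // y /eU /UE.
move=> [e e0 eE]; exists [set y | exists n, shrinking_chain e n 0 x y].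
  split; last by exists 0%N.
  move=> y [n xy]; exists (e / (2 * A0) ^+ n.+1).
    by rewrite divr_gt0// exprn_gt0// mulr_gt0.
  move=> w wy; exists n.+1; exact: shrinking_chain_rcons xy wy.
move=> y [n /(shrinking_chain_lt e0) xy]; apply: eE.
by move: xy; rewrite expr0 divr1.
Qed.

Lemma qclosureP x (E : set X) :
  qclosure rho E x <-> forall e, 0 < e -> exists2 y, E y & rho y x < e.
Proof.
split=> [cE e e0 | h U /nbhs_qball [e e0 eU]].
  have [|y [Ey yx]] := cE (qball rho x e); last by exists y.
  by apply/nbhs_qball; exists e.
by have [y Ey yx] := h e e0; exists y; split=> //; exact: eU.
Qed.

Lemma qinteriorP x (E : set X) :
  qinterior rho E x <-> exists2 e, 0 < e & qball rho x e `<=` E.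
Proof. exact: nbhs_qball. Qed.

Lemma qclosure_qclosure (E F : set X) :
  E `<=` qclosure rho F -> qclosure rho E `<=` qclosure rho F.
Proof.
move=> EF x /qclosureP cE; apply/qclosureP => e e0.
have e0' : 0 < e / (2 * A0) by rewrite divr_gt0// mulr_gt0// quasi_constant_gt0.
have [y /EF/qclosureP cF yx] := cE _ e0'; have [z Fz zy] := cF _ e0'.
exists z => //; apply: rho_triangle_lt zy yx _.
by rewrite le_eqVlt; apply/orP; left; apply/eqP; field;
  rewrite gt_eqF// quasi_constant_gt0.
Qed.

End QuasiMetricTopology.

Section Packing.
Variables (R : realType) (X : Type) (rho : X -> X -> R) (A0 : R) (A1 : nat).
Hypothesis rho_qm : quasi_metric rho A0.
Hypothesis rho_doubling : geometrically_doubling rho A1.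

(** Each halving of the radius costs a factor [A1]; once the radius is below
    [s / (2 * A0)], a ball holds at most one of the points. *)
Lemma packing (p : nat -> X) (s : R) (m : nat) (y : X) (r : R) (u : seq nat) :
  0 < r -> 2 * A0 * (r / 2 ^+ m) <= s -> uniq u ->
  {in u &, forall a b, a <> b -> s <= rho (p a) (p b)} ->
  {in u, forall a, rho (p a) y < r} ->
  (size u <= A1 ^ m)%N.
Proof.
have A0p := quasi_constant_gt0 rho_qm.
elim: m y r u => [|m IH] y r u r0 rs uu us ur.
  rewrite expn0; case: u uu us ur => [|a [|b u]]//= /andP[+ _] us ur.
  rewrite inE negb_or => /andP[/eqP ab _].
  have := us a b (mem_head _ _) ltac:(by rewrite !inE eqxx orbT) ab.
  rewrite leNgt => /negP[]; apply: (rho_triangle_lt rho_qm (z := y)).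
  - by apply: ur; rewrite inE eqxx.
  - by rewrite (rho_sym rho_qm); apply: ur; rewrite !inE eqxx orbT.
  - by rewrite expr0 in rs; lra.
have [n [c [nA yc]]] := rho_doubling y r0.
pose near_ i a := `[< rho (p a) (c i) < r / 2 >].
have cover v : {subset v <= u} -> (size v <= \sum_i count (near_ i) v)%N.
  elim: v => [|a v IHv]//= vu; rewrite big_split/= -add1n leq_add//; last first.
    by apply: IHv => b bv; apply: vu; rewrite inE bv orbT.
  have [|i _ ai] := yc (p a); first by apply: ur; apply: vu; exact: mem_head.
  by rewrite (bigD1 i)//= /near_ asboolT.
apply: leq_trans (cover u _) _ => //.
apply: (@leq_trans (\sum_(i < n) A1 ^ m)); last first.
  by rewrite sum_nat_const card_ord expnS leq_mul2r nA orbT.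
apply: leq_sum => i _; rewrite -size_filter; apply: (IH (c i) (r / 2)).
- lra.
- suff -> : r / 2 / 2 ^+ m = r / 2 ^+ m.+1 by [].
  by rewrite exprS; field; rewrite expf_neq0.
- exact: filter_uniq.
- by move=> a b; rewrite !mem_filter => /andP[_ au] /andP[_ bu]; exact: us.
- by move=> a; rewrite mem_filter => /andP[/asboolP].
Qed.

(** The exponent depends only on the ratio of [r] and [s], which makes the
    packing bound uniform over all scales. *)
Lemma packing_exponent (r s : R) : 0 < s ->
  exists m : nat, 2 * A0 * (r / 2 ^+ m) <= s.
Proof.
have A0p := quasi_constant_gt0 rho_qm => s0.
pose t := 2 * A0 * r / s; exists (Num.bound `|t|).
have tm : t <= 2 ^+ Num.bound `|t|.
  apply: le_trans (ler_norm _) _.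
  apply: le_trans (ltW (archi_boundP (normr_ge0 t))) _.
  have /ltnW : (Num.bound `|t| < 2 ^ Num.bound `|t|)%N by rewrite ltn_expl.
  by rewrite -(ler_nat R) natrX.
rewrite mulrA ler_pdivrMr ?exprn_gt0// [leRHS]mulrC -ler_pdivrMr//.
Qed.

Lemma separated_finite (D : set nat) (p : nat -> X) (y : X) (r s : R) : 0 < s ->
  (forall a b, D a -> D b -> a <> b -> s <= rho (p a) (p b)) ->
  finite_set [set a | D a /\ rho (p a) y < r].
Proof.
move=> s0 Ds; apply: contrapT => inf.
have [r0|r0] := ltP 0 r; last first.
  apply: inf; rewrite (_ : mkset _ = set0); first exact: finite_set0.
  apply/seteqP; split=> // a [_ /=]; have [_ h _ _ _] := rho_qm.
  by have := h (p a) y; lra.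
have [m rm] := packing_exponent r s0.
have [B BD Bm] := infinite_set_fset (A1 ^ m).+1 inf.
have : (size B <= A1 ^ m)%N; last by rewrite leqNgt Bm.
apply: (packing (p := p) (y := y) r0 rm) => [|a b aB bB|a aB].
- exact: (fset_uniq B).
- by apply: Ds; [have [] := BD a aB | have [] := BD b bB].
- by have [] := BD a aB.
Qed.

(** Only finitely many points compete for the minimum. *)
Lemma separated_min_dist (D : set nat) (p : nat -> X) (y : X) (r s : R) : 0 < s ->
  (forall a b, D a -> D b -> a <> b -> s <= rho (p a) (p b)) ->
  (exists2 a, D a & rho y (p a) < r) -> min_dist_lt rho D p y r.
Proof.
move=> s0 Ds [a0 Da0 ya0].
have /finite_seqP [u uE] := separated_finite y r s0 Ds.
have inu a : D a -> rho y (p a) < r -> a \in u.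
  move=> Da ya; suff : [set` u] a by [].
  by rewrite -uE; split=> //; rewrite (rho_sym rho_qm).
have uin a : a \in u -> D a.
  by move=> au; have : [set` u] a by []; rewrite -uE => -[].
have [a [au amin]] : exists a, a \in u /\
    forall b, b \in u -> rho y (p a) <= rho y (p b).
  have : u != [::] by apply: contraTneq (inu _ Da0 ya0) => ->.
  elim: {uE inu uin} u => // c [|d v] IH _.
    by exists c; rewrite mem_head; split=> // b; rewrite inE => /eqP ->.
  have [//|e [ev emin]] := IH.
  have [ce|ec] := leP (rho y (p c)) (rho y (p e)).
    exists c; rewrite mem_head; split=> // b; rewrite inE => /orP[/eqP -> //|].
    by move=> /emin; exact: le_trans.
  exists e; rewrite inE ev orbT; split=> // b; rewrite inE => /orP[/eqP ->|].
    exact: ltW.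
  exact: emin.
exists a; last by apply: le_lt_trans (amin _ (inu _ Da0 ya0)) ya0.
split=> [|b Db]; first exact: uin.
have [/(inu _ Db)/amin//|] := ltP (rho y (p b)) r.
apply: le_trans; apply: le_trans (amin _ (inu _ Da0 ya0)) _.
exact: ltW.
Qed.

End Packing.

(** * Dyadic cubes from separated and dense points *)

Section Cubes.
Variables (R : realType) (X : Type) (rho : X -> X -> R) (A0 : R) (A1 : nat).
Variables (delta : R) (A : int -> set nat) (z : int -> nat -> X).
Hypothesis rho_qm : quasi_metric rho A0.
Hypothesis rho_doubling : geometrically_doubling rho A1.
Hypothesis delta_gt0 : 0 < delta.
Hypothesis delta_lt1 : delta < 1.
Hypothesis delta_small : 96 * A0 ^+ 6 * delta <= 1.
Hypothesis z_sep : forall k a b, A k a -> A k b -> a <> b ->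
  c_0 A0 * delta ^ k <= rho (z k a) (z k b).
Hypothesis z_dense : forall k y,
  min_dist_lt rho (A k) (z k) y (C_0 A0 * delta ^ k).

Notation zpar := (new_parent rho A0 delta A z).
Notation "p <=z q" := (index_le zpar p q) (at level 70).

Let A0_ge1 : 1 <= A0. Proof. by have [] := rho_qm. Qed.

Let A0_gt0 : 0 < A0. Proof. exact: lt_le_trans A0_ge1. Qed.

Let deltaX_gt0 k : 0 < delta ^ k. Proof. exact: exprz_gt0. Qed.

Let deltaXS k : delta ^ (k + 1) = delta * delta ^ k.
Proof. by rewrite expfzDr ?gt_eqF// expr1z mulrC. Qed.

Let deltaX_le k l : k <= l -> delta ^ l <= delta ^ k.
Proof.
move=> kl; have -> : l = k + `|l - k|%N%:Z by lia.
rewrite expfzDr ?gt_eqF// ler_piMr//; first exact: ltW.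
by rewrite -exprnP exprn_ile1// ltW.
Qed.

Let c0_gt0 : 0 < c_0 A0.
Proof. by rewrite /c_0 invr_gt0 mulr_gt0// exprn_gt0. Qed.

Let A0_delta_small : A0 ^+ 2 * delta <= 96^-1.
Proof.
apply: (@le_trans _ _ (A0 ^+ 6 * delta)); last first.
  by rewrite -[leRHS]mulr1 ler_pdivlMl// mulrA.
by rewrite ler_pM2r// ler_weXn2l.
Qed.

Lemma near_parent_uniq k b a a' :
  near_parent rho A0 delta A z k b a -> near_parent rho A0 delta A z k b a' ->
  a = a'.
Proof.
move=> [Aa ba] [Aa' ba']; apply: contrapT => aa'.
have := z_sep Aa Aa' aa'; rewrite leNgt => /negP[].
apply: (rho_triangle_lt rho_qm (z := z (k + 1) b)) _ ba' _.
  rewrite (rho_sym rho_qm); exact: ba.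
by rewrite le_eqVlt; apply/orP; left; apply/eqP; field; rewrite gt_eqF.
Qed.

Lemma zpar_idx k b a : zpar k b a -> A k a.
Proof. by move=> [_ [[]|[_ []]]]. Qed.

Lemma zpar_idx_child k b a : zpar k b a -> A (k + 1) b.
Proof. by case. Qed.

Lemma zpar_uniq k b a a' : zpar k b a -> zpar k b a' -> a = a'.
Proof.
move=> [_ [na | [nn fa mina]]] [_ [na' | [nn' fa' mina']]].
- exact: near_parent_uniq na na'.
- by case: nn'; exists a.
- by case: nn; exists a'.
- by apply/eqP; rewrite eqn_leq mina// mina'.
Qed.

Lemma zpar_ex k b : A (k + 1) b -> exists a, zpar k b a.
Proof.
move=> Ab; have [[a na]|nn] := pselect (exists a, near_parent rho A0 delta A z k b a).
  by exists a; split=> //; left.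
have : exists a, `[< fallback_parent rho A0 delta A z k b a >].
  have [a [Aa _] ba] := z_dense k (z (k + 1) b).
  by exists a; apply/asboolP.
move=> /ex_minnP [a /asboolP fa mina]; exists a; split=> //; right; split=> //.
by move=> a' /asboolP; exact: mina.
Qed.

Lemma zpar_dist k b a : zpar k b a ->
  rho (z (k + 1) b) (z k a) < C_0 A0 * delta ^ k.
Proof.
move=> [_ [[_ ba]|[_ [_ //]]]]; apply: lt_le_trans ba _.
rewrite ler_pM2r//; have A01 := A0_ge1.
apply: (@le_trans _ _ 1); last by rewrite /C_0; lra.
have A03 : 1 <= A0 ^+ 3 by rewrite exprn_ege1.
rewrite (_ : _ * _ = (8 * A0 ^+ 3)^-1); last first.
  by rewrite /c_0; field; rewrite gt_eqF.
rewrite invf_le1; lra.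
Qed.

(** The distances along a chain of parents add up to a geometric series that
    is dominated by its first term. *)
Lemma descendant_dist k l a b : (l, b) <=z (k, a) ->
  rho (z l b) (z k a) < C_1 A0 * delta ^ k.
Proof.
move=> ba; have kl := index_le_level ba; move: ba.
have [n ln] : exists n : nat, l = k + n%:Z by exists `|l - k|%N; lia.
rewrite {}ln {kl l}; have A01 := A0_ge1.
elim: n k a => [|n IH] k a.
  rewrite addr0 => /index_le_eq ->; rewrite (rho_refl rho_qm) mulr_gt0//.
  by rewrite /C_1 /C_0 !mulr_gt0.
have -> : k + n.+1%:Z = k + 1 + n by lia.
move=> /index_le_last [[]|[c [bc ca]]]; first by lia.
apply: (rho_triangle_lt rho_qm) (IH _ _ bc) (zpar_dist ca) _.
rewrite deltaXS /C_1 /C_0.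
rewrite [leLHS](_ : _ = (4 * A0 * (A0 ^+ 2 * delta) + 2 * A0 ^+ 2) * delta ^ k);
  last by ring.
rewrite ler_pM2r//; have := A0_delta_small; nra.
Qed.

(** The first step from [z k a] dominates the distance, so passing from a
    descendant to a nearby point costs no factor [A0].  This is what bounds the
    closures [Qbar] by the balls of radius [C_1 A0 * delta ^ k]. *)
Lemma near_descendant_dist k l a b y : (l, b) <=z (k, a) ->
  rho y (z l b) < delta ^ k / 2 -> rho y (z k a) < C_1 A0 * delta ^ k.
Proof.
move=> ba yb; have Dk := deltaX_gt0 k; have A01 := A0_ge1.
have A02 : A0 <= A0 ^+ 2 by nra.
have [[lk ab]|[c [bc ca]]] := index_le_last ba.
  rewrite lk ab in yb; apply: lt_trans yb _.
  by rewrite mulrC ltr_pM2r// /C_1 /C_0; nra.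
apply: (rho_triangle_lt rho_qm) _ (zpar_dist ca) _.
  by apply: (rho_triangle_lt rho_qm) yb (descendant_dist bc) (lexx _).
rewrite deltaXS /C_1 /C_0.
rewrite [leLHS](_ : _ = (A0 ^+ 2 / 2 + 4 * A0 ^+ 2 * (A0 ^+ 2 * delta)
  + 2 * A0 ^+ 2) * delta ^ k); last by field.
rewrite ler_pM2r//; have := A0_delta_small; nra.
Qed.

Lemma Qbar_dist k a y : Qbar rho A0 delta A z k a y ->
  rho y (z k a) < C_1 A0 * delta ^ k.
Proof.
have e0 : 0 < delta ^ k / 2 by rewrite divr_gt0.
move=> /(qclosureP rho_qm)/(_ _ e0)[_ [l [b [ba ->]]] zy].
by apply: near_descendant_dist ba _; rewrite (rho_sym rho_qm).
Qed.

(** A point of [Qhat k b] near a point of the small ball has an ancestor of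
    level [k + 1] so close to [z k a] that the parent of the latter must be
    [(k, a)]. *)
Lemma small_ball_Qbar k a b y : A k a -> rho y (z k a) < c_1 A0 * delta ^ k ->
  A k b -> Qbar rho A0 delta A z k b y -> b = a.
Proof.
move=> Aa ya Ab yb; have Dk := deltaX_gt0 k; have A01 := A0_ge1.
(* The first bound excludes points of level [k], by separation; the second one
   puts [y] within reach of [near_descendant_dist] at level [k + 1]. *)
pose e := Num.min (c_0 A0 * delta ^ k / (2 * A0)) (delta ^ (k + 1) / 2).
have e0 : 0 < e.
  by rewrite lt_min !divr_gt0// mulr_gt0.
have [_ [l [c [cb ->]]] zy] := (qclosureP rho_qm _ _).1 yb _ e0.
move: zy; rewrite lt_min => /andP[zy1 zy2].
have [[lk cb']|[c' [cc' c'b]]] := index_le_last cb.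
  rewrite lk cb' in zy1; apply: contrapT => ba.
  have := z_sep Ab Aa ba; rewrite leNgt => /negP[].
  apply: (rho_triangle_lt rho_qm) zy1 ya _.
  rewrite [leLHS](_ : _ = (2^-1 + (3 * A0)^-1) * (c_0 A0 * delta ^ k)); last first.
    by rewrite /c_1; field; rewrite gt_eqF.
  rewrite ler_piMl ?mulr_ge0// ?ltW//.
  have : (3 * A0)^-1 <= 3^-1 by rewrite lef_pV2 ?posrE ?mulr_gt0//; lra.
  lra.
have c'a : near_parent rho A0 delta A z k c' a.
  split=> //; have yc' : rho y (z (k + 1) c') < C_1 A0 * delta ^ (k + 1).
    by apply: near_descendant_dist cc' _; rewrite (rho_sym rho_qm).
  rewrite (rho_sym rho_qm) in yc'.
  apply: (rho_triangle_lt rho_qm) yc' ya _.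
  rewrite deltaXS.
  suff H : A0 * (C_1 A0 * delta + c_1 A0) <= (2 * A0)^-1 * c_0 A0.
    rewrite [leLHS](_ : _ = A0 * (C_1 A0 * delta + c_1 A0) * delta ^ k).
      by rewrite ler_pM2r.
    by ring.
  rewrite /C_1 /C_0 /c_1 /c_0 -subr_ge0.
  (* With [c_1] equal to [c_0 / (3 * A0 ^ 2)], the bound amounts exactly to the
     smallness of [delta]. *)
  rewrite [leRHS](_ : _ = (1 - 96 * A0 ^+ 6 * delta) / (24 * A0 ^+ 3)).
    by rewrite divr_ge0 ?subr_ge0// mulr_ge0// exprn_ge0// ltW.
  by field; rewrite gt_eqF.
apply: (zpar_uniq c'b); split; first exact: zpar_idx_child c'b.
by left.
Qed.

Lemma bounded_index_finite k y r : finite_set [set a | A k a /\ rho (z k a) y < r].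
Proof.
apply: (separated_finite rho_qm rho_doubling _ _ _ (@z_sep k)).
by rewrite mulr_gt0.
Qed.

Lemma scale_cvg0 (e : R) : 0 < e ->
  exists N : nat, forall n : nat, (N <= n)%N -> C_0 A0 * delta ^ n < e.
Proof.
move=> e0; have C0 : 0 < C_0 A0 by rewrite mulr_gt0.
have : \forall n \near \oo, delta ^+ n < e / C_0 A0.
  have /cvgrPdist_lt/(_ _ (divr_gt0 e0 C0)) : delta ^+ n @[n --> \oo] --> (0 : R).
    by apply: cvg_expr; rewrite gtr0_norm.
  apply: filterS => n; rewrite sub0r normrN; apply: le_lt_trans; exact: ler_norm.
move=> [N _ NP]; exists N => n /NP /=.
by rewrite ltr_pdivlMr// mulrC.
Qed.

(** An infinite pigeonhole principle. *)
Lemma ultra_finite_bigcup (T : Type) (U : set_system T) (S : set nat)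
    (V : nat -> set T) : UltraFilter U -> finite_set S ->
  U (\bigcup_(a in S) V a) -> exists2 a, S a & U (V a).
Proof.
move=> UU /finite_fsetP[S' ->] US; apply: contrapT => noa.
have UC : U (\bigcap_(a in [set` S']) ~` V a).
  apply: filter_bigI => a aS.
  have [UV|//] := in_ultra_setVsetC (V a) UU.
  by case: noa; exists a.
have [t [[a aS Vt] nt]] := filter_ex (filterI US UC).
exact: (nt a aS Vt).
Qed.

(** A point of every level within [C_0 delta ^ n] of [y] has ancestors on all
    coarser levels.  These ancestors may depend on [n], but on each level they
    range over a finite set, so an ultrafilter on the [n] selects one of them
    for all levels at once, and consistently. *)
Lemma branch_ex y : exists f : int -> nat, [/\ forall k, A k (f k),
  forall k, zpar k (f (k + 1)) (f k) &
  forall k, Qbar rho A0 delta A z k (f k) y].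
Proof.
have /choice[t tP] : forall n : nat, exists a, A n a /\
    rho y (z n a) < C_0 A0 * delta ^ n.
  by move=> n; have [a [Aa _] ya] := z_dense n y; exists a.
have [U [UU oU]] := ultraFilterLemma eventually_filter.
have large (N : nat) : U [set n | (N <= n)%N] by apply: oU; exact: nbhs_infty_ge.
pose V k a := [set n : nat | (n%:Z, t n) <=z (k, a)].
have /choice[f fP] : forall k, exists a, A k a /\ U (V k a).
  move=> k.
  pose r := A0 * (C_1 A0 * delta ^ k + C_0 A0 * delta ^ k).
  have [|a [Aa _] Va] := ultra_finite_bigcup (V := V k) UU
    (bounded_index_finite k y r); last by exists a.
  apply: filterS (large `|k|%N) => n /= kn.
  have kn' : k <= n by lia.
  have [a na] := ancestor_ex zpar_idx zpar_ex kn' (tP n).1.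
  exists a => //; split; first exact: (index_le_idx zpar_idx (tP n).1 na).
  apply: (rho_triangle_lt rho_qm (z := z n (t n))) _ _ (lexx _).
    rewrite (rho_sym rho_qm); exact: descendant_dist.
  rewrite (rho_sym rho_qm); apply: lt_le_trans (tP n).2 _.
  by rewrite ler_pM2l ?mulr_gt0// deltaX_le.
exists f; split=> [k|k|k]; first exact: (fP k).1.
  have [n [nk nk1]] := filter_ex (filterI (fP k).2 (fP (k + 1)).2).
  apply: index_le_child.
  apply: (ancestor_chain zpar_idx zpar_ex zpar_uniq (tP n).1 _ nk nk1); lia.
apply/(qclosureP rho_qm) => e e0; have [N Ne] := scale_cvg0 e0.
have [n [nk /= Nn]] := filter_ex (filterI (fP k).2 (large N)).
exists (z n (t n)); first by exists n, (t n).
by rewrite (rho_sym rho_qm); apply: lt_trans (tP n).2 (Ne _ Nn).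
Qed.

Lemma Qbar_openC k b : @open (qtop rho) (~` Qbar rho A0 delta A z k b).
Proof. by rewrite openC; exact: closed_closure. Qed.

(** Once each point has a branch, the cubes are the fibres of the branch map,
    so nestedness and disjointness are facts about the index tree. *)
Section BranchCubes.
Variable br : X -> int -> nat.
Hypothesis br_idx : forall y k, A k (br y k).
Hypothesis br_par : forall y k, zpar k (br y (k + 1)) (br y k).
Hypothesis br_Qbar : forall y k, Qbar rho A0 delta A z k (br y k) y.

Definition branch_cube k a : set X := [set y | br y k = a].

Lemma branch_le y k l : k <= l -> (l, br y l) <=z (k, br y k).
Proof.
move=> kl; have [n ->] : exists n : nat, l = k + n%:Z.
  by exists `|l - k|%N; lia.
elim: n => [|n IH]; first by rewrite addr0; exact: rt_refl.
have -> : k + n.+1%:Z = k + n + 1 by lia.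
apply: rt_trans IH; exact/index_le_step/br_par.
Qed.

Lemma branch_cube_Qbar k a : branch_cube k a `<=` Qbar rho A0 delta A z k a.
Proof. by move=> y <-. Qed.

Lemma Qtilde_branch_cube k a :
  Qtilde rho A0 delta A z k a `<=` branch_cube k a.
Proof.
move=> y ya; apply: contrapT => bra; apply: ya.
by exists (br y k) => //; split.
Qed.

Lemma branch_small_ball k a y : A k a -> rho y (z k a) < c_1 A0 * delta ^ k ->
  br y k = a.
Proof. by move=> Aa ya; exact: (small_ball_Qbar Aa ya). Qed.

(** The small ball of [(l, b)] contains its centre, so the branch of [z l b]
    passes through [(l, b)], hence through all the ancestors of [(l, b)]. *)
Lemma branch_descendant k l a b : A l b -> (l, b) <=z (k, a) ->
  br (z l b) k = a.
Proof.
move=> Ab ba; have kl := index_le_level ba.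
have brl : br (z l b) l = b.
  apply: branch_small_ball => //; rewrite (rho_refl rho_qm) mulr_gt0//.
  by rewrite /c_1 mulr_gt0// invr_gt0 mulr_gt0// exprn_gt0.
have := branch_le (z l b) kl; rewrite brl => bb.
exact: (ancestor_uniq zpar_uniq bb ba).
Qed.

Lemma Qhat_branch_cube k a : A k a ->
  Qhat rho A0 delta A z k a `<=` branch_cube k a.
Proof.
move=> Aa _ [l [b [ba ->]]]; apply: branch_descendant (ba).
exact: (descendant_idx zpar_idx_child Aa ba).
Qed.

Lemma branch_dyadic_system : dyadic_system rho A0 delta A z branch_cube.
Proof.
by move=> k a Aa; split; [exact: Qtilde_branch_cube | exact: branch_cube_Qbar].
Qed.

(** Only finitely many of the closed sets [Qbar k b] come near a given point. *)
Lemma branch_cube_interior k a : A k a ->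
  Qtilde rho A0 delta A z k a = qinterior rho (branch_cube k a).
Proof.
move=> Aa; apply/seteqP; split=> y; last first.
  move=> /(qinteriorP rho_qm)[e e0 ea] [b [Ab ba]].
  move=> /(qclosureP rho_qm)/(_ _ e0)[w wb wy]; apply: ba.
  by rewrite -(Qhat_branch_cube Ab wb) (ea _ wy).
(* If the branch of a point within [delta ^ k] of [y] passes through [(k, b)],
   then [z k b] is within [r] of [y]. *)
move=> ya; pose r := A0 * (C_1 A0 * delta ^ k + delta ^ k).
have [S SE] := finite_fsetP.1 (bounded_index_finite k y r).
have /(nbhs_qball rho_qm) [e e0 eS] : @nbhs _ (qtop rho) y
    (\bigcap_(b in [set` S]) [set w : X | Qbar rho A0 delta A z k b w -> b = a]).
  apply: filter_bigI => b bS; have [<-|ba] := pselect (b = a).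
    exact: filterS filterT.
  have Ab : A k b by have : [set` S] b by []; rewrite -SE => -[].
  have yCb : @nbhs _ (qtop rho) y (~` Qbar rho A0 delta A z k b).
    apply: (@open_nbhs_nbhs (qtop rho)); split; first exact: Qbar_openC.
    by move=> yb; apply: ya; exists b.
  by apply: filterS yCb => w nw /nw.
apply/(qinteriorP rho_qm); exists (Num.min e (delta ^ k)).
  by rewrite lt_min e0 deltaX_gt0.
move=> w; rewrite /qball /= lt_min => /andP[we wk].
suff brS : [set` S] (br w k) by exact: (eS w we _ brS).
rewrite -SE; split=> //.
apply: (rho_triangle_lt rho_qm (z := w)) _ wk (lexx _).
by rewrite (rho_sym rho_qm); exact: Qbar_dist.
Qed.

Lemma branch_cube_closure k a : A k a ->
  Qbar rho A0 delta A z k a = qclosure rho (branch_cube k a).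
Proof.
move=> Aa; apply/seteqP; split; apply: (qclosure_qclosure rho_qm).
  move=> y /(Qhat_branch_cube Aa) ya; apply/(qclosureP rho_qm) => e e0.
  by exists y; rewrite ?(rho_refl rho_qm).
exact: branch_cube_Qbar.
Qed.

Lemma branch_cube_nested k l a b y : k <= l ->
  branch_cube k a y -> branch_cube l b y -> branch_cube l b `<=` branch_cube k a.
Proof.
move=> kl <- <- w brw; have := branch_le w kl; rewrite brw => wy.
exact: (ancestor_uniq zpar_uniq wy (branch_le y kl)).
Qed.

Lemma branch_dyadic_properties : dyadic_properties rho A0 delta A z branch_cube.
Proof.
split.
- by move=> k a Aa; split; [exact: branch_cube_interior | exact: branch_cube_closure].
- move=> k l a b Aa Ab kl.
  have [[y [ya yb]]|ndisj] := pselect (branch_cube k a `&` branch_cube l b !=set0).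
    by left; exact: branch_cube_nested ya yb.
  by right; apply/eqP; apply: contra_notT ndisj => /set0P.
- move=> k; split; last by move=> a b _ _ [y [<- <-]].
  by apply/seteqP; split=> // y _; exists (br y k).
- move=> k a Aa; split=> y; first exact: branch_small_ball.
  by move=> /branch_cube_Qbar/Qbar_dist.
- move=> k l a b Aa Ab kl lbka.
  (* An inclusion of cubes forces the order of the indices, since the cube of
     [(l, b)] contains [z l b]. *)
  have lb : br (z l b) l = b by apply: branch_descendant => //; exact: rt_refl.
  have ka : br (z l b) k = a by apply: lbka.
  have ba : (l, b) <=z (k, a) by have := branch_le (z l b) kl; rewrite lb ka.
  move=> y; rewrite /cube_ball /qball /= => yb.
  have [[lk ab]|[c [bc ca]]] := index_le_last ba; first by rewrite -lk -ab.
  apply: near_descendant_dist ba _; apply: lt_le_trans yb _.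
  apply: (@le_trans _ _ (C_1 A0 * delta ^ (k + 1))).
    by rewrite ler_pM2l ?mulr_gt0// deltaX_le// (index_le_level bc).
  rewrite deltaXS mulrA [leRHS]mulrC ler_pM2r//.
  have := A0_delta_small; rewrite /C_1 /C_0; lra.
Qed.

End BranchCubes.

Theorem dyadic_cubes_ex : exists Q : int -> nat -> set X,
  dyadic_system rho A0 delta A z Q /\ dyadic_properties rho A0 delta A z Q.
Proof.
have /choice[br brP] := branch_ex.
exists (branch_cube br); split.
  by apply: branch_dyadic_system => y k; have [] := brP y.
by apply: branch_dyadic_properties => y k; have [] := brP y.
Qed.

End Cubes.

(** * Random choice of new dyadic points *)

(** Greedy colouring: each vertex takes the first colour that its earlier
    neighbours do not use. *)
Lemma greedy_coloring (e : rel nat) (N : nat) :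
  (forall b u, uniq u -> {in u, forall c, (c < b)%N && e c b} ->
     (size u <= N)%N) ->
  exists col : nat -> nat, (forall b, (col b <= N)%N) /\
    forall b c, (c < b)%N -> e c b -> col c <> col b.
Proof.
move=> degN.
pose used s b : seq nat := [seq nth 0%N s c | c <- iota 0 b & e c b].
pose free s b := find (fun i => i \notin used s b) (iota 0 N.+1).
pose cols := fix cols n :=
  if n is n'.+1 then rcons (cols n') (free (cols n') n') else [::].
pose col b := free (cols b) b.
have colsE n : cols n = mkseq col n.
  by elim: n => // n IH; rewrite mkseqS -IH.
have has_free s b : has (fun i => i \notin used s b) (iota 0 N.+1).
  apply: contraT => /hasPn noFree.
  have : (size (iota 0 N.+1) <= size (used s b))%N.
    apply: uniq_leq_size; first exact: iota_uniq.
    by move=> i /noFree; rewrite negbK.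
  rewrite size_iota size_map leqNgt ltnS.
  rewrite (degN b)// ?filter_uniq ?iota_uniq//.
  by move=> c; rewrite mem_filter mem_iota add0n andbC.
have free_lt s b : (free s b < N.+1)%N.
  by have := has_free s b; rewrite has_find size_iota.
exists col; split=> [b|b c cb ecb]; first by rewrite -ltnS free_lt.
move=> cE; have := nth_find 0%N (has_free (cols b) b).
rewrite nth_iota; last exact: free_lt.
rewrite add0n => /negP[]; rewrite -/(free _ _) -/(col b) -cE.
apply/mapP; exists c; first by rewrite mem_filter ecb mem_iota.
by rewrite colsE nth_mkseq.
Qed.

Section RandomPoints.
Variables (R : realType) (X : Type) (rho : X -> X -> R) (A0 : R) (A1 : nat).
Variables (delta : R) (A : int -> set nat) (x : int -> nat -> X).
Variable par : int -> nat -> nat -> Prop.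
Hypothesis rho_qm : quasi_metric rho A0.
Hypothesis rho_doubling : geometrically_doubling rho A1.
Hypothesis delta_gt0 : 0 < delta.
Hypothesis delta_small : 4 * A0 ^+ 2 * delta <= 1.
Hypothesis x_ref : reference_points rho delta A x.
Hypothesis par_ref : reference_order rho A0 delta A x par.

Let A0_ge1 : 1 <= A0. Proof. by have [] := rho_qm. Qed.

Let A0_gt0 : 0 < A0. Proof. exact: lt_le_trans A0_ge1. Qed.

Let deltaX_gt0 k : 0 < delta ^ k. Proof. exact: exprz_gt0. Qed.

Let deltaXS k : delta ^ (k + 1) = delta * delta ^ k.
Proof. by rewrite expfzDr ?gt_eqF// expr1z mulrC. Qed.

Lemma child_idx k b a : par k b a -> A (k + 1) b /\ A k a.
Proof. by have [h _ _ _] := par_ref; exact: h. Qed.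

Lemma parent_uniq k b a a' : par k b a -> par k b a' -> a = a'.
Proof.
have [_ h _ _] := par_ref => ba ba'.
have [c [_ cu]] := h k b (child_idx ba).1.
by rewrite -(cu _ ba) (cu _ ba').
Qed.

Lemma child_dist k b a : par k b a -> rho (x (k + 1) b) (x k a) < delta ^ k.
Proof. by have [_ _ _ h] := par_ref; exact: h. Qed.

(** By doubling, the graph of conflicts between the points of level [k + 1] has
    bounded degree.  The bound is the same for all [k] because the separation
    and the range of the conflicts are both proportional to [delta ^ k]. *)
Lemma conflict_coloring : exists (N : nat) (col : int -> nat -> nat),
  (forall k b, (col k b <= N)%N) /\
  forall k b c, A (k + 1) b -> A (k + 1) c -> b <> c ->
    rho (x (k + 1) b) (x (k + 1) c) < 2 * A0 * delta ^ k -> col k b <> col k c.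
Proof.
have [m mP] := packing_exponent rho_qm (2 * A0) delta_gt0.
exists (A1 ^ m)%N.
suff /choice[col colP] : forall k, exists col : nat -> nat,
    (forall b, (col b <= A1 ^ m)%N) /\
    forall b c, A (k + 1) b -> A (k + 1) c -> b <> c ->
    rho (x (k + 1) b) (x (k + 1) c) < 2 * A0 * delta ^ k -> col b <> col c.
  by exists col; split=> k; [exact: (colP k).1 | exact: (colP k).2].
move=> k; pose e b c := `[< [/\ A (k + 1) b, A (k + 1) c &
  rho (x (k + 1) b) (x (k + 1) c) < 2 * A0 * delta ^ k] >].
have [b u uu ub|col [colN colP]] := @greedy_coloring e (A1 ^ m)%N.
  apply: (packing rho_qm rho_doubling (p := x (k + 1)) (s := delta ^ (k + 1))
    (y := x (k + 1) b) (r := 2 * A0 * delta ^ k)) => //.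
  - by rewrite !mulr_gt0.
  - rewrite deltaXS [leLHS](_ : _ = 2 * A0 * (2 * A0 / 2 ^+ m) * delta ^ k).
      by rewrite ler_pM2r.
    by rewrite -!mulrA [delta ^ k * _]mulrC.
  - move=> c d /ub/andP[_ /asboolP[Ac _ _]] /ub/andP[_ /asboolP[Ad _ _]].
    exact: x_ref.1.
  - by move=> c /ub/andP[_ /asboolP[]].
exists col; split=> // b c Ab Ac bc xbc.
have := bc; move=> /eqP; rewrite neq_ltn => /orP[lt_bc|lt_cb].
  by apply: colP => //; apply/asboolP.
apply/nesym/colP => //; apply/asboolP; split=> //.
by rewrite (rho_sym rho_qm).
Qed.

Variable col : int -> nat -> nat.
Hypothesis colP : forall k b c, A (k + 1) b -> A (k + 1) c -> b <> c ->
  rho (x (k + 1) b) (x (k + 1) c) < 2 * A0 * delta ^ k -> col k b <> col k c.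

Definition central_child k a b : Prop :=
  par k b a /\ rho (x (k + 1) b) (x k a) < delta ^ (k + 1).

Lemma central_child_ex k a : A k a -> exists b, central_child k a b.
Proof.
move=> Aa; have [b [Ab _]] := x_ref.2 (k + 1) (x k a).
rewrite (rho_sym rho_qm) => ba; exists b; split=> //.
have [_ _ h _] := par_ref; apply: h => //; apply: lt_le_trans ba _.
rewrite deltaXS ler_pM2r// -[leRHS]mul1r ler_pdivlMr ?mulr_gt0//.
apply: le_trans delta_small; rewrite mulrC ler_pM2r//.
have A01 := A0_ge1; nra.
Qed.

(** Siblings are close to their common parent, hence to each other. *)
Lemma sibling_col k a b c : par k b a -> par k c a -> col k b = col k c -> b = c.
Proof.
move=> ba ca bc; apply: contrapT => nbc.
apply: (colP (child_idx ba).1 (child_idx ca).1 nbc) bc.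
apply: (rho_triangle_lt rho_qm (child_dist ba)).
  by rewrite (rho_sym rho_qm); exact: child_dist ca.
by rewrite le_eqVlt; apply/orP; left; apply/eqP; ring.
Qed.

(** [b] is the child that the random colour [j] selects for [(k, a)].  The second
    clause ensures that every child is selected by its own colour, and the third
    one allows a central child only as a substitute. *)
Definition designated k j a b : Prop :=
  [/\ par k b a, forall c, par k c a -> col k c = j -> c = b &
      col k b = j \/ central_child k a b].

Lemma designated_ex k j a : A k a -> exists b, designated k j a b.
Proof.
move=> Aa; have [[b [ba bj]]|nb] := pselect (exists b, par k b a /\ col k b = j).
  exists b; split=> //; last by left.
  by move=> c ca cj; apply: sibling_col ca ba _; rewrite cj.
have [b cb] := central_child_ex Aa; exists b; split; [by case: cb | | by right].
by move=> c ca cj; case: nb; exists c.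
Qed.

(** Closer than [c_0 A0 * delta ^ k] to a central child of [(k, a')], the point
    would be closer than [delta ^ k / (2 * A0)] to [x k a'], and [(k, a')] would
    be its parent. *)
Lemma central_child_sep k a a' b b' : par k b a -> central_child k a' b' ->
  a <> a' -> c_0 A0 * delta ^ k <= rho (x (k + 1) b) (x (k + 1) b').
Proof.
move=> ba [b'a' b'd] aa'; rewrite leNgt; apply/negP => bb'; apply: aa'.
apply: (parent_uniq ba); have [_ _ h _] := par_ref; apply: h.
- exact: (child_idx ba).1.
- exact: (child_idx b'a').2.
apply: (rho_triangle_lt rho_qm bb' b'd).
rewrite deltaXS -mulrDl mulrA ler_pM2r// /c_0 -subr_ge0.
rewrite [leRHS](_ : _ = (1 - 4 * A0 ^+ 2 * delta) / (4 * A0)).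
  by rewrite divr_ge0 ?subr_ge0// mulr_ge0// ltW.
by field; rewrite gt_eqF.
Qed.

Lemma designated_sep k j a a' b b' : designated k j a b ->
  designated k j a' b' -> a <> a' ->
  c_0 A0 * delta ^ k <= rho (x (k + 1) b) (x (k + 1) b').
Proof.
move=> [ba _ [bj|cb]] [b'a' _ b'c] aa'; last first.
  by rewrite (rho_sym rho_qm); exact: central_child_sep b'a' cb (nesym aa').
case: b'c => [b'j|cb']; last exact: central_child_sep ba cb' aa'.
have bb' : b <> b' by move=> bb'; apply: aa'; apply: parent_uniq ba _; rewrite bb'.
apply: (@le_trans _ _ (2 * A0 * delta ^ k)).
  rewrite ler_pM2r//; apply: (@le_trans _ _ 1); last by have A01 := A0_ge1; lra.
  have A02 : 1 <= A0 ^+ 2 by rewrite exprn_ege1.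
  rewrite /c_0 invf_le1; lra.
rewrite leNgt; apply/negP => /(colP (child_idx ba).1 (child_idx b'a').1 bb').
by rewrite bj b'j.
Qed.

Lemma designated_points (w : int -> nat) (child : int -> nat -> nat) :
  (forall k a, A k a -> designated k (w k) a (child k a)) ->
  new_dyadic_points rho A0 delta A x par (fun k a => x (k + 1) (child k a)).
Proof.
move=> childP.
have sep k a b : A k a -> A k b -> a <> b ->
    c_0 A0 * delta ^ k <= rho (x (k + 1) (child k a)) (x (k + 1) (child k b)).
  by move=> Aa Ab; apply: designated_sep; exact: childP.
split=> // [k a Aa|k y].
  by exists (child k a) => //; apply: index_le_step; have [] := childP k a Aa.
apply: (separated_min_dist rho_qm rho_doubling _ (@sep k)).
  by rewrite mulr_gt0// /c_0 invr_gt0 mulr_gt0// exprn_gt0.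
have [a [Aa _] ya] := x_ref.2 k y; exists a => //.
have [ca _ _] := childP k a Aa.
apply: (rho_triangle_lt rho_qm ya).
  by rewrite (rho_sym rho_qm); exact: child_dist ca.
by rewrite /C_0 le_eqVlt; apply/orP; left; apply/eqP; ring.
Qed.

End RandomPoints.

(** * Independent uniform coordinates from digits *)

Definition discrete_nat : measurableType default_measure_display := nat.

Notation nat_seqs := (prod_space (fun _ : int => discrete_nat)).

Section Digits.
Variables (R : realType) (N : nat).
Local Notation b := N.+1.
Local Notation U := (uniform_prob (@ltr01 R)).
Local Notation mble := (@measurable _ (measurableTypeR R)).

Definition digit (j : nat) (u : R) : nat :=
  (Num.truncn (u * b%:R ^+ j.+1) %% b)%N.

Definition base_interval (n i : nat) : set R :=
  [set` `[(i%:R / b%:R ^+ n), (i.+1%:R / b%:R ^+ n)[].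

Lemma base_intervalP n i u :
  base_interval n i u <-> i%:R <= u * b%:R ^+ n < i.+1%:R.
Proof.
by rewrite /base_interval /= in_itv/= ler_pdivrMr ?exprn_gt0// ltr_pdivlMr ?exprn_gt0.
Qed.

Lemma base_interval_parent n i :
  base_interval n.+1 i `<=` base_interval n (i %/ b).
Proof.
move=> u /base_intervalP; rewrite exprSr mulrA => /andP[iu ui].
apply/base_intervalP; set v := u * _ in iu ui *.
have b0 : 0 < b%:R :> R by [].
apply/andP; split.
  rewrite -(ler_pM2r b0) -natrM; apply: le_trans iu.
  by rewrite ler_nat leq_divM.
rewrite -(ltr_pM2r b0) -natrM; apply: lt_le_trans ui _.
by rewrite ler_nat ltn_ceil.
Qed.

Lemma digit_base_interval n i u :
  base_interval n.+1 i u -> digit n u = (i %% b)%N.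
Proof. by move=> /base_intervalP ui; rewrite /digit (truncn_def ui). Qed.

Lemma base_interval_trivIset n : trivIset setT (base_interval n).
Proof.
move=> i j _ _ [u [/base_intervalP ui /base_intervalP uj]].
by rewrite -(truncn_def ui) (truncn_def uj).
Qed.

Lemma measurable_base_interval n i : mble (base_interval n i).
Proof. exact: measurable_itv. Qed.

Lemma U_base_interval n i : (i < b ^ n)%N ->
  U (base_interval n i) = ((b%:R ^+ n)^-1)%:E.
Proof.
move=> ib; have bn : 0 < b%:R ^+ n :> R by rewrite exprn_gt0.
have sub : base_interval n i `<=` `[0, 1]%classic.
  move=> u /base_intervalP /andP[iu ui]; rewrite /= in_itv/=; apply/andP; split.
    by rewrite -(ler_pM2r bn) mul0r (le_trans _ iu).
  rewrite -(ler_pM2r bn) mul1r (le_trans (ltW ui))//.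
  by rewrite -natrX ler_nat.
rewrite /uniform_prob integral_uniform_pdf setIidl//.
rewrite (eq_integral (fun=> 1%:E)); last first.
  move=> u; rewrite inE => /sub; rewrite /= in_itv/= /uniform_pdf => ->.
  by rewrite subr0 invr1.
rewrite integral_cst/=; last exact: measurable_base_interval.
rewrite mul1e lebesgue_measure_itv/= lte_fin.
rewrite ltr_pM2r ?invr_gt0// ltr_nat ltnSn -EFinD -mulrBl -natrB// subSnn.
by rewrite mul1r.
Qed.

(** The condition that digit [j] belongs to [F j] for all [j < n], for the
    expansion with [n] digits of an integer [i] below [b ^ n]; the last digit is
    the remainder of [i]. *)
Fixpoint digits_in (F : nat -> set nat) (n i : nat) : bool :=
  if n is n'.+1 then digits_in F n' (i %/ b) && `[< F n' (i %% b)%N >] else true.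

Lemma digits_inP F n i u : base_interval n i u ->
  (forall j, (j < n)%N -> F j (digit j u)) <-> digits_in F n i.
Proof.
elim: n i => [|n IH] i ui //=; have /IH [F1 F2] := base_interval_parent ui.
split=> [Fu|/andP[Fi /asboolP Fn] j].
  apply/andP; split; first by apply: F1 => j jn; apply: Fu; exact: ltnW.
  by apply/asboolP; rewrite -(digit_base_interval ui); exact: Fu.
rewrite ltnS leq_eqVlt => /orP[/eqP -> | ]; last exact: F2.
by rewrite (digit_base_interval ui).
Qed.

Definition digit_ratio (E : set nat) : R :=
  (\sum_(r < b) `[< E r >]%:R) / b%:R.

Lemma digits_in_count F n :
  (\sum_(0 <= i < b ^ n) (digits_in F n i)%:R) / b%:R ^+ n =
  \prod_(j < n) digit_ratio (F j) :> R.
Proof.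
elim: n => [|n IH]; first by rewrite big_ord0 big_nat1 divr1.
rewrite big_ord_recr /= -IH expnSr big_nat_mul exprSr /digit_ratio.
rewrite [LHS](_ : _ = (\sum_(0 <= i < b ^ n) (digits_in F n i)%:R *
   \sum_(r < b) `[< F n r >]%:R) / (b%:R ^+ n * b%:R)); last first.
  congr (_ / _); apply: eq_bigr => q _.
  rewrite mulSn addnC -{1}[(q * b)%N]add0n big_addn addnC addnK big_mkord mulr_sumr.
  apply: eq_bigr => r _.
  rewrite addnC divnMDl// modnMDl divn_small// modn_small// addn0.
  by case: digits_in; rewrite ?mul1r ?mul0r.
by rewrite -mulr_suml invfM mulrACA.
Qed.

Lemma measurable_digit j (E : set nat) : mble [set u | E (digit j u)].
Proof.
have c0 : 0 < b%:R ^+ j.+1 :> R by rewrite exprn_gt0.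
have mlt i : mble [set u : R | (Num.truncn (u * b%:R ^+ j.+1) < i)%N].
  case: i => [|i]; first by rewrite (_ : mkset _ = set0)// -subset0.
  rewrite (_ : mkset _ = [set` `]-oo, (i.+1%:R / b%:R ^+ j.+1)[])//.
  apply/seteqP; split=> u /=; by rewrite in_itv/= ltr_pdivlMr// ltnS truncn_le_nat.
rewrite (_ : mkset _ = \bigcup_(i in [set i | E (i %% b)%N])
   ([set u : R | (Num.truncn (u * b%:R ^+ j.+1) < i.+1)%N] `\`
    [set u : R | (Num.truncn (u * b%:R ^+ j.+1) < i)%N])).
  by apply: bigcup_measurable => i _; exact: measurableD.
apply/seteqP; split=> [u Eu|u [i /= Ei []]].
  by exists (Num.truncn (u * b%:R ^+ j.+1)) => //; split=> /=; rewrite ?ltnSn ?ltnn.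
rewrite ltnS => iu ui; rewrite /digit.
have -> // : Num.truncn (u * b%:R ^+ j.+1) = i.
by apply/eqP; rewrite eqn_leq iu leqNgt; apply/negP.
Qed.

(** The intervals of length [b ^- n] on which the first [n] digits are
    constant carry the whole mass, so that probabilities of digit events are
    proportions of integers below [b ^ n]. *)
Lemma U_digits F n : U [set u | forall j, (j < n)%N -> F j (digit j u)] =
  (\prod_(j < n) digit_ratio (F j))%:E.
Proof.
set D := mkset _.
have mI i : mble (base_interval n i) by exact: measurable_base_interval.
have mD : mble D.
  rewrite (_ : D = \bigcap_(j in `I_n) [set u | F j (digit j u)])//.
  by apply: bigcap_measurableType => j _; exact: measurable_digit.
have tI : trivIset setT (fun i : 'I_(b ^ n) => base_interval n i).
  by move=> i j _ _ ij; apply/val_inj/(@base_interval_trivIset n).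
have UI (P : pred 'I_(b ^ n)) : U (\bigcup_(i in [set` P]) base_interval n i) =
    ((\sum_(i < b ^ n) (P i)%:R) / b%:R ^+ n)%:E.
  rewrite bigcup_pred measure_bigsetU_ord//.
  rewrite (eq_bigr (fun=> ((b%:R ^+ n)^-1)%:E)); last first.
    by move=> i _; exact: U_base_interval.
  rewrite sumEFin big_mkcond mulr_suml; congr (_%:E); apply: eq_bigr => i _.
  by rewrite unfold_in; case: (P i); rewrite ?mul1r ?mul0r.
pose B := \bigcup_(i in [set` xpredT]) (fun i : 'I_(b ^ n) => base_interval n i) i.
have mB : mble B by rewrite /B bigcup_pred; exact: bigsetU_measurable.
have UB : U B = 1%E.
  rewrite /B (UI xpredT) sumr_const card_ord -natrX divff//.
  by rewrite pnatr_eq0 expn_eq0.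
have UBC : U (~` B) = 0%E.
  apply: etrans (probability_setC _ mB) _.
  by apply: etrans (congr1 (fun t => (1 - t)%E) UB) _; rewrite subee.
have -> : U D = U (D `&` B).
  rewrite -[in LHS](setUIDK D B) measureU/=.
  - rewrite [X in _ + X](_ : _ = 0%E) ?adde0//.
    apply: (subset_measure0 (mu := U) (B := ~` B)) => //.
    + exact: measurableD.
    + exact: measurableC.
  - exact: measurableI.
  - exact: measurableD.
  - by rewrite -subset0 => u [[_ Bu] [_ /(_ Bu)]].
rewrite (_ : D `&` B = \bigcup_(i in [set` (fun i : 'I_(b ^ n) => digits_in F n i)])
    (fun i : 'I_(b ^ n) => base_interval n i) i).
  by rewrite (UI (fun i : 'I_(b ^ n) => digits_in F n i)) -digits_in_count big_mkord.
apply/seteqP; split=> u.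
  by move=> [Du [i _ ui]]; exists i => //; exact/(digits_inP F ui).
move=> [i Fi ui]; split; last by exists i.
exact/(digits_inP F ui).
Qed.

Lemma digit_ratioT : digit_ratio setT = 1.
Proof.
rewrite /digit_ratio (eq_bigr (fun=> 1)); last by move=> r _; rewrite asboolT.
by rewrite sumr_const card_ord divff.
Qed.

Lemma digit_ratio1 (r : nat) : (r <= N)%N -> digit_ratio [set r] = b%:R^-1.
Proof.
rewrite -ltnS => rb; rewrite /digit_ratio (bigD1 (Ordinal rb))//= asboolT//.
rewrite big1 ?addr0 ?mul1r// => i /eqP ir; rewrite asboolF// => /= ir'.
by apply: ir; apply: val_inj.
Qed.

(** Independence of the digits: the positions below [n] outside [s] are left
    free and contribute factors [1]. *)
Lemma U_digits_seq (s : seq nat) (F : nat -> set nat) : uniq s ->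
  U [set u | forall j, j \in s -> F j (digit j u)] =
  (\prod_(j <- s) digit_ratio (F j))%:E.
Proof.
move=> us; pose n := (\max_(j <- s) j).+1.
pose G j := if j \in s then F j else setT.
have sn j : j \in s -> (j < n)%N by move=> js; rewrite ltnS leq_bigmax_seq.
rewrite (_ : mkset _ = [set u | forall j, (j < n)%N -> G j (digit j u)]).
  rewrite U_digits -(big_mkord xpredT (fun j => digit_ratio (G j))).
  congr (_%:E); rewrite (bigID (mem s))/= [X in _ * X]big1 ?mulr1.
    rewrite -big_filter (perm_big s).
      by apply: eq_big_seq => j js; rewrite /G js.
    apply: uniq_perm => // [|j]; first by rewrite filter_uniq// iota_uniq.
    rewrite mem_filter mem_index_iota /=.
    by case: (boolP (j \in s)) => // /sn ->.
  by move=> j /negPf js; rewrite /G js digit_ratioT.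
apply/seteqP; split=> u /= Fu j; rewrite /G.
  by case: ifPn => // js _; exact: Fu.
by move=> js; have := Fu j (sn j js); rewrite /G js.
Qed.

Lemma U_digit j (E : set nat) : U [set u | E (digit j u)] = (digit_ratio E)%:E.
Proof.
have := @U_digits_seq [:: j] (fun=> E) isT; rewrite big_seq1 => <-.
congr (U _); apply/seteqP; split=> u /= Eu; last by apply: Eu; rewrite inE.
by move=> i; rewrite inE => /eqP ->.
Qed.

Definition digit_sequence (u : measurableTypeR R) : nat_seqs :=
  fun k => digit (choice.pickle k) u.

Lemma measurable_digit_sequence : measurable_fun setT digit_sequence.
Proof.
apply: (@measurability _ _ (measurableTypeR R) nat_seqs setT digit_sequence
  (@cylinders _ (fun=> discrete_nat))) => //.
move=> _ [_ [k [E [_ ->]]] <-]; rewrite setTI.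
exact: measurable_digit.
Qed.

HB.instance Definition _ := isMeasurableFun.Build _ _ _ _ digit_sequence
  measurable_digit_sequence.

Definition digit_law : probability nat_seqs R := distribution U digit_sequence.

Lemma digit_law_coordinate k (E : set nat) :
  digit_law [set w : nat_seqs | E (w k)] = (digit_ratio E)%:E.
Proof. exact: U_digit. Qed.

Lemma digit_law_independent : independent_coordinates digit_law.
Proof.
move=> J E mE.
rewrite (eq_bigr (fun k => (digit_ratio (E k))%:E)); last first.
  by move=> k _; exact: digit_law_coordinate.
rewrite prodEFin.
(* The condition on digit [j] is the one on the integer coded by [j], if any. *)
pose F j := [set r | forall k : int, choice.pickle k = j -> E k r].
have FE k : F (choice.pickle k) = E k.
  apply/seteqP; split=> r /= Fr; first exact: Fr.
  by move=> k' /(pcan_inj choice.pickleK) ->.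
rewrite (eq_bigr (fun k => digit_ratio (F (choice.pickle k)))); last first.
  by move=> k _; rewrite FE.
rewrite -(big_map choice.pickle xpredT (fun j => digit_ratio (F j))).
rewrite -U_digits_seq; last first.
  by rewrite map_inj_uniq ?fset_uniq//; exact: pcan_inj choice.pickleK.
congr (U _); apply/seteqP; split=> u /= Fu.
  by move=> _ /mapP[k kJ ->]; rewrite FE; exact: Fu.
by move=> k kJ; rewrite -FE; apply: Fu; apply: map_f.
Qed.

End Digits.

Lemma iid_uniform_ex (R : realType) (N : nat) :
  exists P : probability nat_seqs R,
    independent_coordinates P /\
    forall k j, (j <= N)%N -> P [set w | w k = j] = (N.+1%:R^-1)%:E.
Proof.
exists (digit_law R N); split; first exact: digit_law_independent.
by move=> k j jN; rewrite (digit_law_coordinate R N k [set j]) digit_ratio1.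
Qed.

(** * Random dyadic systems *)

Theorem theorem5p1 (R : realType) (X : Type) (rho : X -> X -> R)
    (A0 : R) (A1 : nat) (delta : R)
    (A : int -> set nat) (x : int -> nat -> X) (par : int -> nat -> nat -> Prop)
    (rho_qm : quasi_metric rho A0)
    (rho_doubling : geometrically_doubling rho A1)
    (delta_gt0 : 0 < delta) (delta_lt1 : delta < 1)
    (delta_small : 96 * A0 ^+ 6 * delta <= 1)
    (x_ref : reference_points rho delta A x)
    (par_ref : reference_order rho A0 delta A x par) :
  exists (d : int -> measure_display) (Omega : forall k, measurableType (d k))
    (P : probability (prod_space Omega) R)
    (z : prod_space Omega -> int -> nat -> X)
    (Q : prod_space Omega -> int -> nat -> set X),
  [/\ forall w, [/\ new_dyadic_points rho A0 delta A x par (z w),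
                    dyadic_system rho A0 delta A (z w) (Q w)
                  & dyadic_properties rho A0 delta A (z w) (Q w)],
      independent_coordinates P,
      forall (w w' : prod_space Omega) (k : int) (a : nat), A k a ->
        w k = w' k -> z w k a = z w' k a
    & exists2 tau0 : R, 0 < tau0 &
        forall (k : int) (a b : nat), index_le par (k + 1, b) (k, a) ->
          measurable [set w : prod_space Omega | z w k a = x (k + 1) b] /\
          (tau0%:E <= P [set w | z w k a = x (k + 1)%R b])%E].
Proof.
have delta_small' : 4 * A0 ^+ 2 * delta <= 1.
  have [A01 _ _ _ _] := rho_qm; apply: le_trans delta_small.
  have A0p : 0 <= A0 by lra.
  rewrite ler_pM2r// ler_pM//; rewrite ?exprn_ge0//; first by lra.
  by rewrite ler_weXn2l.
have [N [col [colN colP]]] :=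
  conflict_coloring rho_qm rho_doubling delta_gt0 x_ref.
have child_ex (t : int * nat * nat) : exists b, A t.1.1 t.2 ->
    designated rho delta x par col t.1.1 t.1.2 t.2 b.
  have [Aa|nA] := pselect (A t.1.1 t.2); last by exists 0%N.
  have [b bP] := designated_ex rho_qm delta_gt0 delta_small' x_ref par_ref colP t.1.2 Aa.
  by exists b.
have [child childP] := choice child_ex.
have [P [Pind Punif]] := iid_uniform_ex R N.
pose z (w : nat_seqs) k a := x (k + 1) (child (k, w k, a)).
have zP w : new_dyadic_points rho A0 delta A x par (z w).
  apply: (designated_points rho_qm rho_doubling delta_gt0 delta_small' x_ref
    par_ref colP (w := w)) => k a; exact: (childP (k, w k, a)).
have Q_ex w : exists Q, dyadic_system rho A0 delta A (z w) Q /\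
    dyadic_properties rho A0 delta A (z w) Q.
  by have [_ sep dense] := zP w; exact: (dyadic_cubes_ex rho_qm rho_doubling).
have [Q QP] := choice Q_ex.
exists (fun=> default_measure_display), (fun=> discrete_nat), P, z, Q; split => //.
- by move=> w; have [] := QP w.
- by move=> w w' k a _; rewrite /z => ->.
exists N.+1%:R^-1; first by rewrite invr_gt0.
move=> k a b /index_le_child ba.
have mz (E : set nat) : measurable [set w : nat_seqs | E (w k)].
  by apply: sub_sigma_algebra; exists k, E.
split; first exact: (mz [set j | x (k + 1) (child (k, j, a)) = x (k + 1) b]).
rewrite -(Punif k (col k b))//; apply: le_measure; rewrite ?inE.
- exact: (mz [set col k b]).
- exact: (mz [set j | x (k + 1) (child (k, j, a)) = x (k + 1) b]).
move=> w /= wk; rewrite /z; congr (x _ _); apply/esym.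
by have [_ h _] := childP (k, w k, a) (child_idx par_ref ba).2; exact: h.
Qed.
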